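(* Let $(\underline{\ell}_{\mathcal D}^n)_{n\ge 1}$, with $\underline{\ell}_{\mathcal D}^n\in \underline V_{\mathcal D}^{k,k+1}$, be a solution to the scheme (S) described in the context, and let $(u_{\mathcal M}^n,u_{\mathcal E}^n)_{n\geq 1}$ be the associated reconstructed discrete densities, i.e. $u_{\mathcal M}^n=\exp(\ell_{\mathcal M}^n)$ and $u_{\mathcal E}^n=\exp(\ell_{\mathcal E}^n)$ for $n\ge1$ (and $u^0_{\mathcal M}=u^{in}$). For $n\ge 1$ let $\underline w_{\mathcal D}^n=\underline\ell_{\mathcal D}^n+\underline\phi_{\mathcal D}-\log(\rho)\,\underline 1_{\mathcal D}$. Then: (i) the mass is preserved along time: for all integers $n\ge 1$, $\int_\Omega u_{\mathcal M}^n=\int_\Omega u^{in}=M$; (ii) a discrete entropy/dissipation relation holds: for all integers $n\ge 0$, $$\frac{\mathbb E^{n+1}-\mathbb E^n}{\Delta t}\le -\mathbb D^{n+1},$$ where the discrete entropy and dissipation are defined by $$\mathbb E^n=\int_\Omega u_{\mathcal M}^\infty\,\Phi_1\!\left(\frac{u_{\mathcal M}^n}{u_{\mathcal M}^\infty}\right)\ (n\ge0),\qquad \mathbb D^n=\mathcal T_{\mathcal D}(\underline\ell_{\mathcal D}^n,\underline w_{\mathcal D}^n,\underline w_{\mathcal D}^n)\ge 0\ (n\ge 1),$$ with $\Phi_1(s)=s\log(s)-s+1$ for $s>0$ and $\Phi_1(0)=1$.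
   Context: **Data.** $\Omega\subset\mathbb R^d$, $d\in\{2,3\}$, is open, bounded, connected and polytopal. $\Lambda\in L^\infty(\Omega;\mathbb R^{d\times d})$ is uniformly elliptic: there is $\lambda_\flat>0$ such that for a.e. $x\in\Omega$, $\Lambda(x)\xi\cdot\xi\ge\lambda_\flat|\xi|^2$ for all $\xi\in\mathbb R^d$. $\phi\in C^1(\overline\Omega)$. $u^{in}\in L^1(\Omega)$ is non-negative with $\int_\Omega u^{in}\log(u^{in})<\infty$, and $M=\int_\Omega u^{in}>0$. (The scheme approximates $\partial_t u-\mathrm{div}(\Lambda(\nabla u+u\nabla\phi))=0$ with homogeneous Neumann (no-flux) boundary conditions and initial datum $u^{in}$.) **Mesh.** A discretisation is a pair $\mathcal D=(\mathcal M,\mathcal E)$. $\mathcal M$ is a finite family of nonempty disjoint open polytopal subsets $K\subset\Omega$ (cells) with $\overline\Omega=\bigcup_{K\in\mathcal M}\overline K$. $\mathcal E$ is a partition of the mesh skeleton $\bigcup_{K\in\mathcal M}\partial K$ into faces $\sigma$, each contained in a hyperplane. $\mathcal E_K$ is the set of faces of $K$, $n_{K,\sigma}$ is the unit normal vector to $\sigma\in\mathcal E_K$ pointing outwards from $K$, and $h_X$ is the diameter of a set $X$. **Discrete unknowns.** Fix an integer $k\ge0$. $\mathbb P^j(X)$ denotes the polynomial functions on $X$ of degree at most $j$; $\mathbb P^j(X)^d$ denotes the corresponding vector fields; $\Pi^j_Y$ is the $L^2(Y)$-orthogonal projector onto $\mathbb P^j(Y)$. Let $$\underline V_{\mathcal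 D}^{k,k+1}=\{\underline v_{\mathcal D}=((v_K)_{K\in\mathcal M},(v_\sigma)_{\sigma\in\mathcal E}) : v_K\in\mathbb P^{k+1}(K)\ \forall K\in\mathcal M,\ v_\sigma\in\mathbb P^k(\sigma)\ \forall \sigma\in\mathcal E\}.$$ The restriction of $\underline v_{\mathcal D}$ to $K$ is $\underline v_K=(v_K,(v_\sigma)_{\sigma\in\mathcal E_K})\in\underline V_K^{k,k+1}=\mathbb P^{k+1}(K)\times\prod_{\sigma\in\mathcal E_K}\mathbb P^k(\sigma)$. To $\underline v_{\mathcal D}$ one associates the piecewise polynomial functions $v_{\mathcal M}$ on $\Omega$ and $v_{\mathcal E}$ on $\bigcup_{K}\partial K$ with $v_{\mathcal M}|_K=v_K$ and $v_{\mathcal E}|_\sigma=v_\sigma$. $\underline 1_{\mathcal D}$ is the element with all $1_K=1$ and $1_\sigma=1$. $\underline\phi_{\mathcal D}$ is the interpolate of $\phi$: $\phi_K=\Pi_K^{k+1}(\phi)$, $\phi_\sigma=\Pi_\sigma^k(\phi)$. **Discrete operators.** For $\underline v_K\in\underline V_K^{k,k+1}$, $G_K^k(\underline v_K)\in\mathbb P^k(K)^d$ is defined by $$\int_K G_K^k(\underline v_K)\cdot\tau=\int_K\nabla v_K\cdot\tau+\sum_{\sigma\in\mathcal E_K}\int_\sigma(v_\sigma-v_K)\,\tau\cdot n_{K,\sigma}\quad\forall\tau\in\mathbb P^k(K)^d,$$ and for $\sigma\in\mathcal E_K$, $J_{K,\sigma}(\underline v_K)=\Pi_\sigma^k(v_K)-v_\sigma$.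 Let $\Lambda_{K\sigma}=\|\Lambda_{|K}n_{K,\sigma}\cdot n_{K,\sigma}\|_{L^\infty(\sigma)}$, where the trace of $\Lambda_{|K}$ on $\sigma$ is assumed to make sense so that $\Lambda_{K\sigma}$ is a well-defined finite non-negative number. **Forms.** Fix parameters $\eta_l>0$, $\eta_{nl}>0$, $\varepsilon\ge0$. Set $$a_K(\underline w_K,\underline v_K)=\int_K\Lambda G_K^k(\underline w_K)\cdot G_K^k(\underline v_K)+\eta_l\sum_{\sigma\in\mathcal E_K}\frac{\Lambda_{K\sigma}}{h_\sigma}\int_\sigma J_{K,\sigma}(\underline w_K)J_{K,\sigma}(\underline v_K),$$ $$\mathcal C_K(\underline\ell_K,\underline w_K,\underline v_K)=\int_K e^{\ell_K}\Lambda G_K^k(\underline w_K)\cdot G_K^k(\underline v_K),$$ $$\mathcal S_K(\underline\ell_K,\underline w_K,\underline v_K)=\eta_{nl}\sum_{\sigma\in\mathcal E_K}\frac{\Lambda_{K\sigma}}{h_\sigma}\int_\sigma\frac{e^{\Pi_\sigma^k(\ell_K)}+e^{\ell_\sigma}}{2}J_{K,\sigma}(\underline w_K)J_{K,\sigma}(\underline v_K),$$ $$\mathcal T_K(\underline\ell_K,\underline w_K,\underline v_K)=\mathcal C_K(\underline\ell_K,\underline w_K,\underline v_K)+\mathcal S_K(\underline\ell_K,\underline w_K,\underline v_K)+\varepsilon h_K^{k+2}a_K(\underline w_K,\underline v_K),$$ $$\mathcal T_{\mathcal D}(\underline\ell_{\mathcal D},\underline w_{\mathcal D},\underline v_{\mathcal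 D})=\sum_{K\in\mathcal M}\mathcal T_K(\underline\ell_K,\underline w_K,\underline v_K).$$ **Scheme (S).** Let $\Delta t>0$. Find $(\underline\ell_{\mathcal D}^n)_{n\ge1}$ in $\underline V_{\mathcal D}^{k,k+1}$ such that, with $u^n_{\mathcal M}=\exp(\ell^n_{\mathcal M})$ for $n\ge1$ and $u^0_{\mathcal M}=u^{in}$ (that is, $u^0_K=u^{in}|_K$ for all $K\in\mathcal M$), for all $n\ge0$, $$\int_\Omega\frac{u_{\mathcal M}^{n+1}-u_{\mathcal M}^n}{\Delta t}\,v_{\mathcal M}=-\mathcal T_{\mathcal D}(\underline\ell_{\mathcal D}^{n+1},\underline\ell_{\mathcal D}^{n+1}+\underline\phi_{\mathcal D},\underline v_{\mathcal D})\quad\forall\underline v_{\mathcal D}\in\underline V_{\mathcal D}^{k,k+1}.$$ **Discrete thermal equilibrium.** $\rho=M/\int_\Omega e^{-\phi_{\mathcal M}}$ and $u^\infty_{\mathcal M}=\rho\,e^{-\phi_{\mathcal M}}$. *)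

(* Defs.v *)
From HB Require Import structures.
From mathcomp Require Import all_boot all_order all_algebra.
From mathcomp Require Import -(notations) mpoly.
From mathcomp Require Import all_classical all_reals all_analysis.
From mathcomp Require Import measurable_realfun.
Set Implicit Arguments. Unset Strict Implicit. Unset Printing Implicit Defensive.
Import Order.TTheory GRing.Theory Num.Theory.
Import numFieldNormedType.Exports.
Local Open Scope classical_set_scope.
Local Open Scope ring_scope.

(* Row vectors carry the product (hence Borel) sigma-algebra. *)
Fact rV_display : measure_display. Proof. exact: default_measure_display. Qed.

Section borel_rV.
Context {R : realType} {n : nat}.
Let coor (i : 'I_n) (x : 'rV[R]_n) : measurableTypeR R := x 0 i.
Let rV_set0 : g_sigma_preimage coor set0. Proof. exact: sigma_algebra0. Qed.
Let rV_setC A : g_sigma_preimage coor A -> g_sigma_preimage coor (~` A).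
Proof. exact: sigma_algebraC. Qed.
Let rV_bigcup (F : _^nat) : (forall i, g_sigma_preimage coor (F i)) ->
  g_sigma_preimage coor (\bigcup_i (F i)).
Proof. exact: sigma_algebra_bigcup. Qed.
HB.instance Definition _ := @isMeasurable.Build rV_display 'rV[R]_n
  (g_sigma_preimage coor) rV_set0 rV_setC rV_bigcup.

Lemma measurable_coord_rV (i : 'I_n) :
  measurable_fun [set: 'rV[R]_n] (fun x : 'rV[R]_n => x 0 i : measurableTypeR R).
Proof.
move=> _ Y mY; rewrite setTI; apply: sub_sigma_algebra => /=.
rewrite -bigcup_seq/=; exists i => /=; first by rewrite mem_index_enum.
by exists Y => //; rewrite setTI.
Qed.

Lemma measurable_fun_rV d (T : measurableType d) (f : T -> 'rV[R]_n) :
  (forall i, measurable_fun [set: T] (fun x => f x 0 i : measurableTypeR R)) ->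
  measurable_fun [set: T] f.
Proof.
move=> mf; have : preimage_set_system [set: T] f (g_sigma_preimage coor)
    `<=` measurable.
  rewrite -g_sigma_preimage_comp; apply: smallest_sub.
    exact: sigma_algebra_measurable.
  elim/big_ind : _ => //; first by move=> A B sA sB; rewrite subUset; split.
  by move=> i _ _ [A mA <-]; exact: mf.
by move=> fS _ A mA; apply: fS; exists A.
Qed.
End borel_rV.

Section lebesgue_rV.
Context {R : realType}.

Definition cons_rV n (p : measurableTypeR R * 'rV[R]_n) : 'rV[R]_n.+1 :=
  row_mx (const_mx p.1 : 'rV_1) p.2.

Definition uncons_rV n (x : 'rV[R]_n.+1) : measurableTypeR R * 'rV[R]_n :=
  (x 0 0, \row_i x 0 (lift 0 i)).

Lemma cons_rV0 n p : @cons_rV n p 0 0 = p.1.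
Proof.
rewrite /cons_rV (_ : 0 = lshift n (0 : 'I_1)); last exact/val_inj.
by rewrite (row_mxEl (const_mx p.1 : 'rV_1) p.2) mxE.
Qed.

Lemma cons_rVS n p i : @cons_rV n p 0 (lift 0 i) = p.2 0 i.
Proof.
rewrite /cons_rV (_ : lift 0 i = rshift 1 i); last exact/val_inj.
by rewrite (row_mxEr (const_mx p.1 : 'rV_1) p.2).
Qed.

Lemma cons_rVK n : cancel (@cons_rV n) (@uncons_rV n).
Proof.
move=> [a x]; congr pair; first by rewrite cons_rV0.
by apply/rowP => i; rewrite mxE cons_rVS.
Qed.

Lemma measurable_cons_rV n : measurable_fun setT (@cons_rV n).
Proof.
apply: measurable_fun_rV => i; have [j ->|->] := unliftP 0 i.
- under eq_fun do rewrite cons_rVS.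
  exact: (measurableT_comp (measurable_coord_rV j) measurable_snd).
- by under eq_fun do rewrite cons_rV0; exact: measurable_fst.
Qed.

Lemma measurable_uncons_rV n : measurable_fun setT (@uncons_rV n).
Proof.
apply/measurable_fun_pairP; split; first exact: measurable_coord_rV.
apply: measurable_fun_rV => i; under eq_fun do rewrite /= mxE.
exact: measurable_coord_rV.
Qed.


Section step.
Variables (n : nat) (mu : {sigma_finite_measure set 'rV[R]_n -> \bar R}).

Definition lebesgue_rV_step : set 'rV[R]_n.+1 -> \bar R :=
  pushforward (@lebesgue_measure R \x mu)%E (@cons_rV n).

Let step : {measure set 'rV[R]_n.+1 -> \bar R} :=
  measure_function_pushforward__canonical__measure_function_Measure
    (@lebesgue_measure R \x mu)%E (@measurable_cons_rV n).

HB.instance Definition _ := isMeasure.Build _ _ _ lebesgue_rV_step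
  (measure0 step) (measure_ge0 step) (@measure_semi_sigma_additive _ _ _ step).

Let step_sigma_finite : sigma_finite setT lebesgue_rV_step.
Proof.
have /sigma_finiteP[F [TF ndF Foo]] := sigma_finiteT (@lebesgue_measure R).
have /sigma_finiteP[G [TG ndG Goo]] := sigma_finiteT mu.
exists (fun k => @uncons_rV n @^-1` (F k `*` G k)).
  rewrite -preimage_bigcup (_ : \bigcup_k _ = setT) ?preimage_setT//.
  rewrite -subTset => -[x y] _.
  have [i _ Fx] : (\bigcup_k F k) x by rewrite -TF.
  have [j _ Gy] : (\bigcup_k G k) y by rewrite -TG.
  exists (maxn i j) => //; split.
    by move: x Fx; exact/subsetPset/ndF/leq_maxl.
  by move: y Gy; exact/subsetPset/ndG/leq_maxr.
move=> k; have [mF Fk] := Foo k; have [mG Gk] := Goo k.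
have mFG : measurable (F k `*` G k) by exact: measurableX.
split; first by rewrite -[X in measurable X]setTI; exact: measurable_uncons_rV.
rewrite /lebesgue_rV_step /pushforward -comp_preimage.
rewrite (_ : _ \o _ = id); last by apply/funext => p /=; rewrite cons_rVK.
by rewrite preimage_id product_measure1E// lte_mul_pinfty// ge0_fin_numE.
Qed.

HB.instance Definition _ := Measure_isSigmaFinite.Build _ _ _
  lebesgue_rV_step step_sigma_finite.

End step.

(* The n-dimensional Lebesgue measure, as an iterated product. *)
Fixpoint lebesgue_rV n : {sigma_finite_measure set 'rV[R]_n -> \bar R} :=
  if n is n'.+1 then lebesgue_rV_step (lebesgue_rV n')
  else \d_(0 : 'rV[R]_0).


Definition plane_chart m n (p : 'rV[R]_n) (P : 'M[R]_(m, n)) (y : 'rV[R]_m) :=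
  p + y *m P.

Lemma measurable_plane_chart m n p P : measurable_fun setT (@plane_chart m n p P).
Proof.
apply: measurable_fun_rV => i.
under eq_fun do rewrite /plane_chart !mxE.
apply: measurable_funD => //; apply: measurable_sum => j.
by apply: measurable_funM => //; exact: measurable_coord_rV.
Qed.

Section surface_measure.
Variables (m n : nat) (p : 'rV[R]_n) (P : 'M[R]_(m, n)).

Definition surface_measure : set 'rV[R]_n -> \bar R :=
  pushforward (lebesgue_rV m) (plane_chart p P).

Let image : {measure set 'rV[R]_n -> \bar R} :=
  measure_function_pushforward__canonical__measure_function_Measure
    (lebesgue_rV m) (measurable_plane_chart p P).

HB.instance Definition _ := isMeasure.Build _ _ _ surface_measure
  (measure0 image) (measure_ge0 image)
  (@measure_semi_sigma_additive _ _ _ image).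
End surface_measure.

End lebesgue_rV.

Section euclidean.
Context {R : realType} {d : nat}.
Local Notation E := 'rV[R]_d.

Definition dotv (u v : E) : R := \sum_i u 0 i * v 0 i.

(* The norm `|x| of the library on row vectors is the maximum norm. *)
Definition enorm (x : E) : R := Num.sqrt (dotv x x).

Definition diam (X : set E) : R := sup [set enorm (x - y) | x in X & y in X].

(* The matrix A acts on column vectors: [mxact A u] is the row vector of A u. *)
Definition mxact (A : 'M[R]_d) (u : E) : E := u *m A^T.

Definition polyhedron (hs : seq (E * R)) : set E :=
  [set x | forall h, h \in hs -> dotv h.1 x <= h.2].

Definition polytopal (X : set E) : Prop :=
  exists2 s : seq (seq (E * R)),
    forall hs, hs \in s -> bounded_set (polyhedron hs) &
    X = (\bigcup_(hs in [set` s]) polyhedron hs)°.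

Definition boundary (X : set E) : set E := closure X `\` X°.

(* Elements of P^j are represented by polynomial functions on the whole space:
   on an open nonempty set the restriction is injective, while on a face the
   function stands for its restriction. *)
Definition polyfun (j : nat) (f : E -> R) : Prop :=
  exists2 p : mpoly d R, (mmeasure mdeg p <= j.+1)%N &
    f = fun x => meval (fun i => x 0 i) p.

Definition polyfield (j : nat) (F : E -> E) : Prop :=
  forall i, polyfun j (fun x => F x 0 i).

(* The defining property determines the projection mu-almost everywhere on X. *)
Definition L2proj (mu : {measure set E -> \bar R}) (X : set E) (j : nat)
    (f : E -> R) : E -> R :=
  xget (cst 0) [set p | polyfun j p /\
    forall q, polyfun j q -> \int[mu]_(x in X) ((f x - p x) * q x) = 0].

Definition grad (f : E -> R) (x : E) : E := \row_i 'D_(delta_mx 0 i) f x.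

Definition C1_closure (Om : set E) (f : E -> R) : Prop :=
  {within closure Om, continuous f} /\
  forall i, exists2 g : E -> R, {within closure Om, continuous g} &
    forall x, Om x ->
      derivable f x (delta_mx 0 i) /\ 'D_(delta_mx 0 i) f x = g x.

Definition in_Linfty (mu : {measure set E -> \bar R}) (X : set E)
    (f : E -> R) : Prop :=
  measurable_fun X f /\ ('N[mu]_+oo [EFin \o (f \_ X)] < +oo)%E.

(* g is the trace of f from X, in the sense of Lebesgue points: the mean of
   |f - g y| over the part of X in the ball of centre y and radius r vanishes
   as r tends to 0, for almost every y in S. *)
Definition is_trace (X S : set E) (sigma : {measure set E -> \bar R})
    (f g : E -> R) : Prop :=
  \forall y \ae sigma, S y ->
    (fun r : R => let B := X `&` [set x | enorm (x - y) < r] in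
      (fine (lebesgue_rV d B))^-1 *
      \int[lebesgue_rV d]_(x in B) `|f x - g y|) @ 0^'+ --> (0 : R).

End euclidean.

(* The face s lies in the hyperplane that is the image of the isometric chart
   y |-> face_base s + y *m face_dir s. The surface measure is the image of the
   (d-1)-dimensional Lebesgue measure; it does not depend on the chart. *)
Record mesh (R : realType) (d : nat) (Om : set 'rV[R]_d) := Mesh {
  cell : finType;
  face : finType;
  cell_set : cell -> set 'rV[R]_d;
  face_set : face -> set 'rV[R]_d;
  face_base : face -> 'rV[R]_d;
  face_dir : face -> 'M[R]_(d.-1, d);
  normal : cell -> face -> 'rV[R]_d;
  surf := fun s => surface_measure (face_base s) (face_dir s);
  cell_nonempty : forall K, cell_set K !=set0;
  cell_open : forall K, open (cell_set K);
  cell_polytopal : forall K, polytopal (cell_set K);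
  cell_subset : forall K, cell_set K `<=` Om;
  cell_disjoint : forall K L, K != L -> cell_set K `&` cell_set L = set0;
  cell_cover : closure Om = \bigcup_K closure (cell_set K);
  face_disjoint : forall s t, s != t -> face_set s `&` face_set t = set0;
  face_cover : \bigcup_K boundary (cell_set K) = \bigcup_s face_set s;
  face_dir_isometric : forall s, face_dir s *m (face_dir s)^T = 1%:M;
  face_planar : forall s,
    face_set s `<=` range (plane_chart (face_base s) (face_dir s));
  face_measurable : forall s, measurable (face_set s);
  face_surf_gt0 : forall s, (0 < surf s (face_set s))%E;
  (* The boundary of each cell is, up to null sets, a union of faces. *)
  face_of_cell : forall K s, face_set s `<=` boundary (cell_set K) \/
    surf s (face_set s `&` boundary (cell_set K)) = 0%E;
  normal_outward : forall K s, face_set s `<=` boundary (cell_set K) ->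
    [/\ enorm (normal K s) = 1,
        face_dir s *m (normal K s)^T = 0 &
        \forall y \ae surf s, face_set s y -> \forall t \near 0^'+,
          cell_set K (y - t *: normal K s) /\
          ~ cell_set K (y + t *: normal K s)]
}.

Section scheme.
Context {R : realType} {d : nat} {Om : set 'rV[R]_d} (D : mesh Om).
Local Notation E := 'rV[R]_d.
Local Notation leb := (lebesgue_rV d).

Definition faces_of (K : cell D) (s : face D) : bool :=
  `[< face_set s `<=` boundary (cell_set K) >].

(* The components v.1 K and v.2 s are v_K and v_s. *)
Definition dofs := ((cell D -> E -> R) * (face D -> E -> R))%type.

Definition hho_space (k : nat) (v : dofs) : Prop :=
  (forall K, polyfun k.+1 (v.1 K)) /\ (forall s, polyfun k (v.2 s)).

Definition one_dofs : dofs := (fun=> cst 1, fun=> cst 1).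

Definition interpolate (k : nat) (f : E -> R) : dofs :=
  (fun K => L2proj leb (cell_set K) k.+1 f,
   fun s => L2proj (surf s) (face_set s) k f).

(* v_M; its value on the mesh skeleton is irrelevant. *)
Definition cellwise (v : dofs) (x : E) : R :=
  \sum_K (v.1 K \_ (cell_set K)) x.

Definition discrete_grad (k : nat) (K : cell D) (v : dofs) : E -> E :=
  xget (cst 0) [set G | polyfield k G /\
    forall tau, polyfield k tau ->
      \int[leb]_(x in cell_set K) dotv (G x) (tau x) =
      \int[leb]_(x in cell_set K) dotv (grad (v.1 K) x) (tau x) +
      \sum_(s | faces_of K s) \int[surf s]_(x in face_set s)
        ((v.2 s x - v.1 K x) * dotv (tau x) (normal K s))].

Definition jump (k : nat) (K : cell D) (s : face D) (v : dofs) (x : E) : R :=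
  L2proj (surf s) (face_set s) k (v.1 K) x - v.2 s x.

Section forms.
(* trLam K s is the trace on s of the restriction of Lam to K. *)
Variables (k : nat) (Lam : E -> 'M[R]_d) (trLam : cell D -> face D -> E -> 'M[R]_d).
Variables (eta_l eta_nl eps : R).

Definition normal_diffusion (K : cell D) (s : face D) (x : E) : R :=
  dotv (mxact (trLam K s x) (normal K s)) (normal K s).

Definition LamKs (K : cell D) (s : face D) : R :=
  fine 'N[surf s]_+oo [EFin \o (normal_diffusion K s \_ (face_set s))]%E.

Definition form_a (K : cell D) (w v : dofs) : R :=
  \int[leb]_(x in cell_set K)
    dotv (mxact (Lam x) (discrete_grad k K w x)) (discrete_grad k K v x) +
  eta_l * \sum_(s | faces_of K s) LamKs K s / diam (face_set s) *
    \int[surf s]_(x in face_set s) (jump k K s w x * jump k K s v x).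

Definition form_C (K : cell D) (l w v : dofs) : R :=
  \int[leb]_(x in cell_set K) (expR (l.1 K x) *
    dotv (mxact (Lam x) (discrete_grad k K w x)) (discrete_grad k K v x)).

Definition form_S (K : cell D) (l w v : dofs) : R :=
  eta_nl * \sum_(s | faces_of K s) LamKs K s / diam (face_set s) *
    \int[surf s]_(x in face_set s)
      ((expR (L2proj (surf s) (face_set s) k (l.1 K) x) + expR (l.2 s x)) / 2 *
       jump k K s w x * jump k K s v x).

Definition form_TK (K : cell D) (l w v : dofs) : R :=
  form_C K l w v + form_S K l w v +
  eps * diam (cell_set K) ^+ k.+2 * form_a K w v.

Definition form_T (l w v : dofs) : R := \sum_K form_TK K l w v.

Variables (phi uin : E -> R) (dt : R) (l : nat -> dofs).

Definition density (n : nat) (x : E) : R :=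
  if n is 0 then uin x else expR (cellwise (l n) x).

Definition scheme_solution : Prop :=
  (forall n, (0 < n)%N -> hho_space k (l n)) /\
  forall n v, hho_space k v ->
    \int[leb]_(x in Om) ((density n.+1 x - density n x) / dt * cellwise v x) =
    - form_T (l n.+1) (l n.+1 + interpolate k phi) v.

Definition mass : R := \int[leb]_(x in Om) uin x.

Definition rho : R :=
  mass / \int[leb]_(x in Om) expR (- cellwise (interpolate k phi) x).

Definition equilibrium (x : E) : R :=
  rho * expR (- cellwise (interpolate k phi) x).

Definition potential (n : nat) : dofs :=
  l n + interpolate k phi - ln rho *: (one_dofs : dofs).

Definition Phi1 (s : R) : R := if s == 0 then 1 else s * ln s - s + 1.

Definition entropy (n : nat) : R :=
  \int[leb]_(x in Om) (equilibrium x * Phi1 (density n x / equilibrium x)).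

Definition dissipation (n : nat) : R :=
  form_T (l n) (potential n) (potential n).

End forms.
End scheme.

Arguments mass {R d} Om uin.

(* Main.v *)
Require Import Defs.
From mathcomp Require Import all_boot all_order all_algebra.
From mathcomp Require Import -(notations) mpoly.
From mathcomp Require Import all_classical all_reals all_analysis.
From mathcomp Require Import measurable_realfun.
From mathcomp Require Import ring lra.
Set Implicit Arguments. Unset Strict Implicit. Unset Printing Implicit Defensive.
Import Order.TTheory GRing.Theory Num.Theory.
Import numFieldNormedType.Exports.
Local Open Scope classical_set_scope.
Local Open Scope ring_scope.

(* The constants lie in the kernel of the form T in each of its two linear
   arguments: the discrete gradient only sees v_s - v_K and grad v_K, and the
   projection onto P^k(s) commutes with adding a constant. Testing the scheme
   with 1 therefore yields the mass balance. Testing it with w^{n+1}, whose cell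
   values are log (u^{n+1} / u^oo), yields -D^{n+1} on the right, and on the left,
   by convexity of Phi_1, an upper bound of (E^{n+1} - E^n) / dt. Non-negativity
   of D is ellipticity of Lam.

   The cells fill Om only up to the skeleton, which is null because each face
   lies in a hyperplane. Discrete gradients and projections are chosen among
   functions determined almost everywhere; the projection of v_K on a face
   exists by a Gram-Schmidt argument for a semidefinite form on polynomials. *)

(** * Lebesgue and surface measures on row vectors *)

Section lebesgue_rV_theory.
Context {R : realType}.

(** The norm is the maximum norm, so a ball is a finite intersection of coordinate preimages. Radii
    that are not positive are set apart: in dimension 0 the empty intersection is everything, while
    such a ball is empty. *)
Lemma measurable_ball_rV n (x : 'rV[R]_n) (e : R) : measurable (ball x e).
Proof.
have [e0|e0] := ltP 0 e; last first.
  rewrite (_ : ball x e = set0) //; apply/seteqP; split => // y [/lt_le_trans].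
  by move=> /(_ _ e0); rewrite ltxx.
rewrite (_ : ball x e = \bigcap_(i in [set: 'I_n])
   ((fun y : 'rV[R]_n => y 0 i : measurableTypeR R) @^-1` (ball (x 0 i) e))).
  apply: fin_bigcap_measurable => [//|i _].
  rewrite -[X in measurable X]setTI; apply: measurable_coord_rV => //.
  exact: measurable_ball.
apply/seteqP; split => [y [_ yx] i _|y yx]; first exact: yx.
by split => // i j; rewrite ord1; exact: yx.
Qed.

(** The sigma-algebra is generated by the coordinates, so an open set is written as a countable
    union of balls with rational centres and radii [k.+1%:R^-1]. *)
Lemma open_measurable_rV n (A : set 'rV[R]_n) : open A -> measurable A.
Proof.
move=> oA.
pose B (p : 'rV[rat]_n * nat) : set 'rV[R]_n :=
  ball (map_mx ratr p.1 : 'rV[R]_n) (p.2.+1%:R^-1 : R).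
pose F p := if `[< B p `<=` A >] then B p else set0.
have -> : A = \bigcup_p F p.
  apply/seteqP; split => [x Ax|x [p _]]; last first.
    by rewrite /F; case: asboolP => // BA /BA.
  have /nbhs_ballP[e /= e0 xe] : nbhs x A by exact: open_nbhs_nbhs.
  have e20 : 0 < e / 2 by rewrite divr_gt0.
  (* With a radius below [e / 2], a ball that contains [x] lies in the ball of radius [e] about
     [x]. *)
  have [k _ /(_ k (leqnn k)) ke] := near_infty_natSinv_lt (PosNum e20).
  have k0 : 0 < (k.+1%:R : R)^-1 by rewrite invr_gt0 ltr0n.
  have rP i : exists q : rat, ratr q \in `]x 0 i, x 0 i + k.+1%:R^-1[.
    by apply: rat_in_itvoo; rewrite ltrDl.
  have [q qP] := choice rP.
  pose p : 'rV[rat]_n * nat := (\row_i q i, k).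
  have Bx : ball x (k.+1%:R^-1 : R) (map_mx ratr p.1 : 'rV[R]_n).
    split => // i j; rewrite ord1 !mxE /ball/= ltr_norml.
    have := qP j; rewrite in_itv/= => /andP[q1 q2].
    rewrite ltrBrDl -ltrBrDr opprK ltrBlDl (lt_trans q1) ?ltrDl//.
    by rewrite q2.
  exists p => //; rewrite /F asboolT; first exact: ball_sym.
  move=> y By; apply: xe; have := ball_triangle Bx By.
  by apply: le_ball; rewrite (splitr e) lerD// ltW.
apply: countable_bigcupT_measurable => [|p]; first exact: countableP.
by rewrite /F; case: ifP => // _; exact: measurable_ball_rV.
Qed.

Definition cube_rV n (r : R) : set 'rV[R]_n := [set x | forall i, `|x 0 i| <= r].

Arguments cube_rV : clear implicits.

Lemma measurable_cube_rV n r : measurable (cube_rV n r).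
Proof.
rewrite (_ : cube_rV n r = \bigcap_(i in [set: 'I_n])
  ((fun y : 'rV[R]_n => y 0 i : measurableTypeR R) @^-1` `[-r, r])).
  apply: fin_bigcap_measurable => [//|i _].
  by rewrite -[X in measurable X]setTI; exact: measurable_coord_rV.
apply/seteqP; split => [y yx i _|y yx i]; rewrite /= ?in_itv/=.
  by rewrite -ler_norml; exact: yx.
by have := yx i I; rewrite /= in_itv/= -ler_norml.
Qed.

Lemma lebesgue_cube_rV_lty n r : (lebesgue_rV n (cube_rV n r) < +oo)%E.
Proof.
elim: n => [|n IHn]; first by rewrite /= diracE; case: (_ \in _); rewrite ?ltry.
rewrite /= /lebesgue_rV_step /pushforward.
rewrite (_ : _ @^-1` _ = `[-r, r] `*` cube_rV n r).
  rewrite product_measure1E//; last exact: measurable_cube_rV.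
  apply: lte_mul_pinfty => //.
    by rewrite ge0_fin_numE//= lebesgue_measure_itv/=; case: ifP; rewrite ?ltry.
apply/seteqP; split => [[a x]/= h|[a x] /= [ar xr] i].
  split; first by have := h 0; rewrite cons_rV0/= in_itv/= -ler_norml.
  by move=> i; have := h (lift 0 i); rewrite cons_rVS.
have [j ->|->] := unliftP 0 i; first by rewrite cons_rVS.
by rewrite cons_rV0/= ler_norml; move: ar; rewrite in_itv.
Qed.

Lemma le_coord_norm n (x : 'rV[R]_n) i : `|x 0 i| <= `|x|.
Proof.
rewrite [leRHS]/Num.norm /= mx_normrE; apply/bigmax_geP; right => /=.
by exists (ord0, i).
Qed.

Lemma bounded_imageP (T : Type) (V : pseudoMetricNormedZmodType R) (f : T -> V)
    (A : set T) :
  [bounded f x | x in A] <-> exists M, forall x, A x -> `|f x| <= M.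
Proof.
split=> [[M [_ fM]]|[M fM]].
  by exists (M + 1) => x Ax; apply: fM => //; rewrite ltrDl.
exists M; split; first by rewrite num_real.
by move=> N MN x Ax /=; rewrite (le_trans (fM x Ax))// ltW.
Qed.

Lemma bounded_lebesgue_rV n (A : set 'rV[R]_n) :
  measurable A -> bounded_set A -> (lebesgue_rV n A < +oo)%E.
Proof.
move=> mA /bounded_imageP[r Ar].
apply: le_lt_trans (lebesgue_cube_rV_lty n r).
apply: le_measure; rewrite ?inE//; first exact: measurable_cube_rV.
by move=> x Ax i; rewrite (le_trans (le_coord_norm _ _))// Ar.
Qed.

Lemma measurable_dotv n (nu : 'rV[R]_n) : measurable_fun setT (dotv nu).
Proof.
rewrite /dotv; apply: measurable_sum => i.
by apply: measurable_funM => //; exact: measurable_coord_rV.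
Qed.

(** Induction on the dimension, slicing along the first coordinate. If the normal is parallel to the
    first axis, the hyperplane is a point times the whole space; otherwise every slice is a
    hyperplane one dimension lower. *)
Lemma lebesgue_hyperplane0 n (nu : 'rV[R]_n) (c : R) : nu != 0 ->
  lebesgue_rV n [set x | dotv nu x = c] = 0%E.
Proof.
have mH m (nu' : 'rV[R]_m) c' : measurable [set x | dotv nu' x = c'].
  by rewrite -[X in measurable X]setTI; exact: (measurable_dotv nu' measurableT (measurable_set1 c')).
elim: n nu c => [|n IHn] nu c nu0; first by rewrite [nu]thinmx0 eqxx in nu0.
rewrite /= /lebesgue_rV_step /pushforward.
have dE a x : dotv nu (cons_rV (a, x)) =
    nu 0 0 * a + dotv (\row_i nu 0 (lift 0 i)) x.
  rewrite /dotv big_ord_recl cons_rV0; congr (_ + _).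
  by apply: eq_bigr => i _; rewrite cons_rVS !mxE.
have [nu'0|nu'0] := eqVneq (\row_i nu 0 (lift 0 i)) 0.
  have nu00 : nu 0 0 != 0.
    apply: contraNN nu0 => /eqP nu00; apply/eqP/rowP => i; rewrite mxE.
    have [j ->|->//] := unliftP 0 i.
    by move/rowP : nu'0 => /(_ j); rewrite !mxE.
  rewrite (_ : _ @^-1` _ = [set c / nu 0 0] `*` setT).
    by rewrite product_measure1E//= lebesgue_measure_set1 mul0e.
  apply/seteqP; split => [[a x]/=|[a x] /= [-> _]]; rewrite dE nu'0 {1}/dotv.
    rewrite big1 ?addr0 => [<-|i _]; first by rewrite mulrAC divff ?mul1r.
    by rewrite mxE mul0r.
  rewrite big1 ?addr0 => [|i _]; first by rewrite mulrC divfK.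
  by rewrite mxE mul0r.
rewrite /product_measure1 integral0_eq// => a _ /=.
rewrite (_ : xsection _ _ = [set x | dotv (\row_i nu 0 (lift 0 i)) x = c - nu 0 0 * a]).
  exact: IHn.
apply/seteqP; split => [x|x]; rewrite /xsection/= inE/= dE => h.
  by rewrite -h addrAC subrr add0r.
by rewrite h addrC subrK.
Qed.

Lemma dotvE n (x z : 'rV[R]_n) : dotv x z = (x *m z^T) 0 0.
Proof. by rewrite /dotv mxE; apply: eq_bigr => i _; rewrite mxE. Qed.

Lemma dotv_isometric m n (P : 'M[R]_(m, n)) (y : 'rV[R]_m) :
  P *m P^T = 1%:M -> dotv (y *m P) (y *m P) = dotv y y.
Proof.
by move=> PP; rewrite !dotvE trmx_mul mulmxA -(mulmxA y) PP mulmx1.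
Qed.

Lemma surface_measure_lty m n (p : 'rV[R]_n) (P : 'M[R]_(m, n))
    (A : set 'rV[R]_n) : P *m P^T = 1%:M ->
  measurable A -> bounded_set A -> (surface_measure p P A < +oo)%E.
Proof.
move=> PP mA /bounded_imageP[r Ar].
rewrite /surface_measure /pushforward.
(* For [y] in the preimage of [A], each [y 0 i] is at most [dotv y y + 1] in absolute value. The
   isometry turns [dotv y y] into [dotv (y *m P) (y *m P)], and the coordinates of [y *m P] are
   bounded by [r + |p|]. *)
apply: le_lt_trans (lebesgue_cube_rV_lty m (\sum_(i < n) (r + `|p|) ^+ 2 + 1)).
apply: le_measure; rewrite ?inE//; last first.
- move=> y Ay i.
  have le1 (a : R) : `|a| <= a ^+ 2 + 1.
    have [a1|a1] := lerP `|a| 1; first by rewrite (le_trans a1)// lerDr sqr_ge0.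
    rewrite -[a ^+ 2]real_normK ?num_real//.
    by rewrite (@le_trans _ _ (`|a| ^+ 2))// ?lerDl// expr2 ler_peMl// ltW.
  rewrite (le_trans (le1 _))// lerD2r (@le_trans _ _ (dotv y y))//.
    rewrite /dotv (bigD1 i)//= expr2 lerDl sumr_ge0// => j _.
    by rewrite -expr2 sqr_ge0.
  rewrite -(dotv_isometric _ PP) /dotv ler_sum// => j _.
  rewrite -expr2 -[leLHS]real_normK ?num_real// ler_pXn2r ?nnegrE//; last first.
    by rewrite addr_ge0// (le_trans _ (Ar _ Ay)).
  rewrite (le_trans (le_coord_norm _ _))//.
  have -> : y *m P = plane_chart p P y - p by rewrite /plane_chart addrC addKr.
  by rewrite (le_trans (ler_normB _ _))// lerD2r Ar.
- exact: measurable_cube_rV.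
- rewrite -[X in measurable X]setTI; exact: measurable_plane_chart.
Qed.

End lebesgue_rV_theory.

(** * Bounded measurable functions and almost everywhere integrals *)

Section tame.
Context {R : realType} {dd : measure_display} {T : measurableType dd}.
Implicit Types (X : set T) (f g : T -> R).

(** A class closed under sums, products and exponentials, and integrable on sets of finite measure;
    it contains all the discrete functions, which are built from polynomials on bounded sets. *)
Definition tame X f :=
  measurable_fun X f /\ exists M, forall x, X x -> `|f x| <= M.

Lemma tame_cst X c : tame X (fun=> c).
Proof. by split=> //; exists `|c|. Qed.

Lemma tameD X f g : tame X f -> tame X g -> tame X (fun x => f x + g x).
Proof.
move=> [mf [M fM]] [mg [N gN]]; split; first exact: measurable_funD.
by exists (M + N) => x Xx; rewrite (le_trans (ler_normD _ _))// lerD ?fM ?gN.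
Qed.

Lemma tameM X f g : tame X f -> tame X g -> tame X (fun x => f x * g x).
Proof.
move=> [mf [M fM]] [mg [N gN]]; split; first exact: measurable_funM.
by exists (M * N) => x Xx; rewrite normrM ler_pM// ?fM ?gN.
Qed.

Lemma tameB X f g : tame X f -> tame X g -> tame X (fun x => f x - g x).
Proof.
move=> tf tg; apply: tameD => //.
by under eq_fun do rewrite -mulN1r; apply: tameM => //; exact: tame_cst.
Qed.

Lemma tame_sum X (I : Type) (s : seq I) (F : I -> T -> R) :
  (forall i, tame X (F i)) -> tame X (fun x => \sum_(i <- s) F i x).
Proof.
move=> tF; elim: s => [|i s IHs].
  by under eq_fun do rewrite big_nil; exact: tame_cst.
by under eq_fun do rewrite big_cons; exact: tameD.
Qed.

Lemma tame_expR X f : tame X f -> tame X (fun x => expR (f x)).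
Proof.
move=> [mf [M fM]]; split; first exact: measurableT_comp.
exists (expR M) => x Xx; rewrite ger0_norm ?expR_ge0// ler_expR.
by rewrite (le_trans (ler_norm _))// fM.
Qed.

Lemma tame_patch X Y f : measurable X -> measurable Y -> tame X f ->
  tame Y (f \_ X).
Proof.
move=> mX mY [mf [M fM]]; split; last first.
  exists `|M| => x Yx; rewrite patchE; case: ifPn => [/set_mem Xx|_].
    by rewrite (le_trans (fM _ Xx))// ler_norm.
  by rewrite normr0.
apply: (measurable_funS measurableT) => //.
by apply/(measurable_restrictT f mX).
Qed.

Lemma tame_integrable (mu : {measure set T -> \bar R}) X f :
  measurable X -> (mu X < +oo)%E -> tame X f -> mu.-integrable X (EFin \o f).
Proof.
move=> mX muX [mf bf]; apply: measurable_bounded_integrable => //.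
exact/bounded_imageP.
Qed.

End tame.

Section almost_everywhere_integrals.
Context {R : realType} {dd : measure_display} {T : measurableType dd}.
Variable mu : {measure set T -> \bar R}.
Implicit Types (X : set T) (f g : T -> R).

Lemma ae_eq_Rintegral X f g : measurable X ->
  measurable_fun X f -> measurable_fun X g ->
  (\forall x \ae mu, X x -> f x = g x) ->
  \int[mu]_(x in X) f x = \int[mu]_(x in X) g x.
Proof.
move=> mX mf mg fg; congr fine; apply: ae_eq_integral => //.
- exact/measurable_EFinP.
- exact/measurable_EFinP.
- by apply: filterS fg => x /[apply] ->.
Qed.

Lemma ae_Rintegral_eq0 X f : measurable X -> measurable_fun X f ->
  (\forall x \ae mu, X x -> f x = 0) -> \int[mu]_(x in X) f x = 0.
Proof.
move=> mX mf f0; rewrite (@ae_eq_Rintegral _ _ (fun=> 0))//.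
by rewrite /Rintegral integral0_eq.
Qed.

(** Replacing [f] by its absolute value, which agrees with it almost everywhere, makes the integrand
    non-negative everywhere. *)
Lemma ae_Rintegral_ge0 X f : measurable X -> measurable_fun X f ->
  (\forall x \ae mu, X x -> 0 <= f x) -> 0 <= \int[mu]_(x in X) f x.
Proof.
move=> mX mf f0; rewrite (@ae_eq_Rintegral _ _ (fun x => `|f x|))//.
- by apply: Rintegral_ge0.
- exact: measurableT_comp.
- by apply: filterS f0 => x /[apply] f0; rewrite ger0_norm.
Qed.

Lemma ae_le_Rintegral X f g : measurable X ->
  mu.-integrable X (EFin \o f) -> mu.-integrable X (EFin \o g) ->
  (\forall x \ae mu, X x -> f x <= g x) ->
  \int[mu]_(x in X) f x <= \int[mu]_(x in X) g x.
Proof.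
move=> mX jf jg fg; rewrite -subr_ge0 -RintegralB//.
apply: ae_Rintegral_ge0 => //.
  by apply: measurable_funB; apply/measurable_EFinP; apply: measurable_int; eassumption.
by apply: filterS fg => x /[apply]; rewrite subr_ge0.
Qed.

(** Tameness makes the extended integral finite; otherwise a zero real integral could come from
    [fine] sending an infinite value to 0. *)
Lemma Rintegral_sqr_eq0 X f : measurable X -> (mu X < +oo)%E -> tame X f ->
  \int[mu]_(x in X) (f x * f x) = 0 -> \forall x \ae mu, X x -> f x = 0.
Proof.
move=> mX muX tf ff0.
have tff := tameM tf tf.
have : (\int[mu]_(x in X) `|(f x * f x)%:E| = 0)%E.
  rewrite -[LHS]fineK.
    rewrite -[RHS]/(0%R%:E) -[in RHS]ff0; congr (fine _)%:E; apply: eq_integral => x _.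
    by rewrite abse_EFin ger0_norm// -expr2 sqr_ge0.
  apply: integrable_fin_num => //; apply: integrable_abse.
  exact: tame_integrable.
move/ae_eq_integral_abs => /(_ mX); case: tff => [mff _].
move=> /(_ ((measurable_EFinP _ _).2 mff)).
by apply: filterS => x /[apply] -[/eqP]; rewrite mulf_eq0 orbb => /eqP.
Qed.

End almost_everywhere_integrals.

(** * L2 projection onto polynomials *)

Section semidefinite_projection.
Context {R : realFieldType} {W : lmodType R} (B : W -> W -> R).
Hypothesis Bl : forall a u v w, B (a *: u + v) w = a * B u w + B v w.
Hypothesis Bsym : forall u v, B u v = B v u.
Hypothesis Bge0 : forall u, 0 <= B u u.

Let Br a u v w : B w (a *: u + v) = a * B w u + B w v.
Proof. by rewrite Bsym Bl !(Bsym _ w). Qed.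

(* Cauchy-Schwarz, for a form that need not be definite. *)
Lemma semidefinite_radical e : B e e = 0 -> forall f, B f e = 0.
Proof.
move=> e0 f; have h t : 0 <= B f f + 2 * t * B f e.
  have := Bge0 (t *: e + f); rewrite Bl !Br e0 (Bsym e f).
  by congr (0 <= _); ring.
apply/eqP; case: (eqVneq (B f e) 0) => // fe0.
(* This is the [t] at which the affine function bounded below in [h] takes the value -1. *)
have := h (- (B f f + 1) / (2 * B f e)).
suff -> : B f f + 2 * (- (B f f + 1) / (2 * B f e)) * B f e = -1 by rewrite ler0N1.
by field.
Qed.

(** Gram-Schmidt by induction on [s]. Degenerate forms must be allowed, since a nonzero polynomial
    may vanish on a face. *)
Lemma semidefinite_projection (S : W -> Prop) (s : seq W) :
  S 0 -> (forall a u v, S u -> S v -> S (a *: u + v)) ->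
  (forall e, e \in s -> S e) ->
  forall f, exists p, S p /\ forall e, e \in s -> B (f - p) e = 0.
Proof.
move=> S0 SD Ss f.
(* The extra clause, that [p] is orthogonal to whatever is orthogonal to [s], stands in for
   membership of [p] in the span of [s]. *)
suff [p [Sp [fp _]]] : exists p, S p /\ (forall e, e \in s -> B (f - p) e = 0) /\
    forall g, (forall e, e \in s -> B g e = 0) -> B g p = 0 by exists p.
have B0 w : B w 0 = 0.
  by have := Br 1 0 0 w; rewrite scaler0 addr0 mul1r -[LHS]addr0 => /addrI.
have BBl u v w : B (u - v) w = B u w - B v w.
  by rewrite addrC -scaleN1r Bl mulN1r addrC.
elim: s Ss f => [|e s IHs] Ss f; first by exists 0; split.
have {}IHs := IHs (fun e' es => Ss e' (mem_behead (s := e :: s) es)).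
have [pe [Spe [ePe peP]]] := IHs e.
have [pf [Spf [fPf pfP]]] := IHs f.
pose e' := e - pe.
have Be' g : B g e' = B g e - B g pe by rewrite Bsym BBl !(Bsym _ g).
have Se' : S e' by rewrite /e' addrC -scaleN1r; apply: SD => //; apply: Ss; rewrite mem_head.
(* If [e'] is isotropic it lies in the radical, so orthogonality to [e] already follows from
   orthogonality to [s]. Otherwise the component along [e'] is subtracted. *)
have [e'0|e'0] := eqVneq (B e' e') 0.
  exists pf; split => //; split => [x|g gs].
    rewrite inE => /predU1P[->|/fPf//].
    have := semidefinite_radical e'0 (f - pf).
    by rewrite Be' (peP _ fPf) subr0.
  by apply: pfP => x xs; apply: gs; rewrite inE xs orbT.
pose c := B (f - pf) e' / B e' e'.
exists (c *: e' + pf); split; first exact: SD.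
have perp x : x \in s -> B (f - (c *: e' + pf)) x = 0.
  move=> xs; rewrite BBl Bl (ePe _ xs) mulr0 add0r -BBl.
  exact: fPf.
split => [x|g gs].
  rewrite inE => /predU1P[->|/perp//].
  have -> : B (f - (c *: e' + pf)) e = B (f - (c *: e' + pf)) e'.
    by rewrite Be' (peP _ perp) subr0.
  by rewrite opprD addrCA addrC BBl -[c *: e']addr0 Bl (Bsym 0) B0 addr0 divfK// subrr.
have gs' x : x \in s -> B g x = 0 by move=> xs; apply: gs; rewrite inE xs orbT.
by rewrite Br Be' (pfP _ gs') (peP _ gs') gs ?mem_head// subr0 mulr0 addr0.
Qed.

End semidefinite_projection.

Section polyfun.
Context {R : realType} {n : nat}.
Local Notation E := 'rV[R]_n.
Implicit Types (X : set E) (f g : E -> R).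

Lemma polyfun_cst j (c : R) : polyfun j (fun _ : E => c).
Proof.
exists (mpolyC n c); first by rewrite mmeasureC; case: (_ == _).
by apply/funext => x; rewrite mevalC.
Qed.

Lemma polyfunD j f g : polyfun j f -> polyfun j g ->
  polyfun j (fun x => f x + g x).
Proof.
move=> [p pj ->] [q qj ->]; exists (p + q).
  by rewrite (leq_trans (mmeasureD_le _ _ _))// geq_max pj.
by apply/funext => x; rewrite mevalD.
Qed.

Lemma polyfunZ j c f : polyfun j f -> polyfun j (fun x => c * f x).
Proof.
move=> [p pj ->]; exists (c *: p); first exact: leq_trans (mmeasureZ_le _ _ _) pj.
by apply/funext => x; rewrite mevalZ.
Qed.

Lemma meval_tame X (p : mpoly n R) : measurable X -> bounded_set X ->
  tame X (fun x : E => meval (fun i => x 0 i) p).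
Proof.
move=> mX /bounded_imageP[M XM].
have tX i : tame X (fun x : E => x 0 i : R).
  split; first exact: measurable_funS (measurable_coord_rV i).
  by exists M => x Xx; rewrite (le_trans (le_coord_norm _ _))// XM.
have tXn i k : tame X (fun x : E => x 0 i ^+ k : R).
  elim: k => [|k IHk]; first exact: tame_cst.
  by under eq_fun do rewrite exprS; exact: tameM.
under eq_fun do rewrite mevalE; apply: tame_sum => m; apply: tameM.
  exact: tame_cst.
elim: (index_enum _) => [|i s IHs].
  by under eq_fun do rewrite big_nil; exact: tame_cst.
by under eq_fun do rewrite big_cons; exact: tameM.
Qed.

Lemma polyfun_tame X j f : measurable X -> bounded_set X -> polyfun j f ->
  tame X f.
Proof. by move=> mX bX [p _ ->]; exact: meval_tame. Qed.

Variables (mu : {measure set E -> \bar R}) (X : set E).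
Hypotheses (mX : measurable X) (muX : (mu X < +oo)%E) (bX : bounded_set X).

Let integrable_tame f : tame X f -> mu.-integrable X (EFin \o f).
Proof. exact: tame_integrable. Qed.

Lemma L2proj_polyfun j f : polyfun j (L2proj mu X j f).
Proof.
rewrite /L2proj; case: xgetP => [p _ []//|_]; exact: polyfun_cst.
Qed.

Definition is_L2proj j f p := polyfun j p /\
  forall q, polyfun j q -> \int[mu]_(x in X) ((f x - p x) * q x) = 0.

(** The semidefinite form is the integral of the product over [X]; orthogonality is imposed against
    the finitely many monomials that span the polynomials of degree at most [j]. *)
Lemma is_L2proj_exists i j f : polyfun i f -> exists p, is_L2proj j f p.
Proof.
move=> [f' _ ->].
pose ev (p : mpoly n R) := fun x : E => meval (fun k => x 0 k) p.
pose B p q := \int[mu]_(x in X) (ev p x * ev q x).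
have tev p : tame X (ev p) by exact: meval_tame.
have Bl a u v w : B (a *: u + v) w = a * B u w + B v w.
  rewrite /B -RintegralZl//; last exact/integrable_tame/tameM.
  rewrite -RintegralD//; last 2 first.
  - by apply: integrable_tame; apply: tameM; [exact: tame_cst|exact: tameM].
  - by apply: integrable_tame; exact: tameM.
  apply: eq_Rintegral => x _.
  by rewrite /ev mevalD mevalZ mulrDl mulrA.
have Bsym u v : B u v = B v u by apply: eq_Rintegral => x _; rewrite mulrC.
have Bge0 u : 0 <= B u u.
  by apply: Rintegral_ge0 => x _; rewrite -expr2 sqr_ge0.
(* [mmeasure mdeg] is one more than the degree, and 0 at the zero polynomial, hence the bound
   [j.+1]. Likewise [bmultinom n j.+1] enumerates the exponents of degree at most [j]. *)
pose S (p : mpoly n R) := (mmeasure mdeg p <= j.+1)%N.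
have S0 : S 0 by rewrite /S mmeasure0.
have SD a u v : S u -> S v -> S (a *: u + v).
  move=> uS vS; apply: leq_trans (mmeasureD_le _ _ _) _; rewrite geq_max.
  by apply/andP; split => //; exact: leq_trans (mmeasureZ_le _ _ _) uS.
pose s := [seq mpolyX R (bmnm m) | m <- index_enum (bmultinom n j.+1)].
have Ss e : e \in s -> S e.
  by move=> /mapP[m _ ->]; rewrite /S mmeasureX bmdeg.
have [p [Sp pP]] := semidefinite_projection Bl Bsym Bge0 S0 SD Ss f'.
exists (ev p); split; first by exists p.
move=> _ [q qj ->]; rewrite -/(ev q).
have -> : \int[mu]_(x in X) ((ev f' x - ev p x) * ev q x) = B (f' - p) q.
  by apply: eq_Rintegral => x _; rewrite /ev mevalB.
rewrite [q](mpolywE qj).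
have Br a u v w : B w (a *: u + v) = a * B w u + B w v by rewrite Bsym Bl !(Bsym _ w).
elim: (index_enum _) => [|m r IHr].
  rewrite big_nil; have := Br 1 0 0 (f' - p).
  by rewrite scaler0 addr0 mul1r -[LHS]addr0 => /addrI.
rewrite big_cons Br IHr addr0 pP ?mulr0//.
by apply/mapP; exists m => //; exact: mem_index_enum.
Qed.

(** Existence rules out the default value of [xget]. *)
Lemma L2projP i j f : polyfun i f -> is_L2proj j f (L2proj mu X j f).
Proof.
move=> pf; rewrite /L2proj; case: xgetP => [p _//|].
by have [p pP] := is_L2proj_exists j pf => /(_ p) /(_ pP).
Qed.

(** The difference [p - q] is an admissible test function, and the integral of its square is the
    difference of two vanishing integrals. *)
Lemma is_L2proj_ae_unique i j f p q : polyfun i f ->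
  is_L2proj j f p -> is_L2proj j f q -> \forall x \ae mu, X x -> p x = q x.
Proof.
move=> pf [pp fp] [pq fq].
have tf := polyfun_tame mX bX pf.
have tp := polyfun_tame mX bX pp; have tq := polyfun_tame mX bX pq.
have ppq : polyfun j (fun x => p x + (-1) * q x).
  by apply: polyfunD => //; exact: polyfunZ.
have : \forall x \ae mu, X x -> p x + (-1) * q x = 0.
  have tpq := polyfun_tame mX bX ppq.
  apply: Rintegral_sqr_eq0 => //.
  have [fp0 fq0] := (fp _ ppq, fq _ ppq).
  transitivity (\int[mu]_(x in X) ((f x - q x) * (p x + (-1) * q x)) -
      \int[mu]_(x in X) ((f x - p x) * (p x + (-1) * q x))); last first.
    by rewrite fp0 fq0 subrr.
  rewrite -RintegralB//; last 2 first.
  - by apply: integrable_tame; apply: tameM => //; exact: tameB.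
  - by apply: integrable_tame; apply: tameM => //; exact: tameB.
  by apply: eq_Rintegral => x _; ring.
by apply: filterS => x /[apply] /eqP; rewrite mulN1r subr_eq0 => /eqP.
Qed.

(** The right-hand side has the defining property of the projection of [f + c], so uniqueness
    applies. *)
Lemma L2projD_cst i j f c : polyfun i f ->
  \forall x \ae mu, X x -> L2proj mu X j (fun x => f x + c) x = L2proj mu X j f x + c.
Proof.
move=> pf; have pfc : polyfun i (fun x => f x + c).
  by apply: polyfunD => //; exact: polyfun_cst.
apply: (is_L2proj_ae_unique pfc); first exact: L2projP pfc.
have [pp pP] := L2projP j pf; split.
  by apply: polyfunD => //; exact: polyfun_cst.
move=> q /pP <-; apply: eq_Rintegral => x _.
by congr (_ * _); rewrite opprD addrACA subrr addr0.
Qed.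

Lemma L2proj_cst j c : \forall x \ae mu, X x -> L2proj mu X j (fun=> c) x = c.
Proof.
apply: (is_L2proj_ae_unique (polyfun_cst j c)).
  exact: L2projP (polyfun_cst j c).
split; first exact: polyfun_cst.
move=> q _; rewrite -[RHS](Rintegral_set0 mu (fun=> 0)).
by rewrite /Rintegral integral_set0 integral0_eq// => x _; rewrite subrr mul0r.
Qed.

End polyfun.

(** * Geometry of the mesh *)

Section mesh_theory.
Context {R : realType} {d : nat} {Om : set 'rV[R]_d} (D : mesh Om).
Local Notation E := 'rV[R]_d.
Local Notation leb := (lebesgue_rV d).
Hypotheses (d_gt0 : (0 < d)%N) (oOm : open Om) (bOm : bounded_set Om).
Implicit Types (K : cell D) (s : face D).

Let mOm : measurable Om. Proof. exact: open_measurable_rV. Qed.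

Lemma measurable_cell K : measurable (cell_set K).
Proof. exact: (open_measurable_rV (@cell_open _ _ _ D K)). Qed.

Lemma bounded_cell K : bounded_set (cell_set K).
Proof.
have /bounded_imageP[M OmM] := bOm; apply/bounded_imageP.
by exists M => x /cell_subset /OmM.
Qed.

Lemma leb_cell_lty K : (leb (cell_set K) < +oo)%E.
Proof. exact: bounded_lebesgue_rV (measurable_cell K) (bounded_cell K). Qed.

Lemma bounded_face K s : faces_of K s -> bounded_set (face_set s).
Proof.
move=> /asboolP sK; have /bounded_imageP[M KM] := bounded_cell K.
apply/bounded_imageP; exists (M + 1) => x /sK[clx _].
(* A point of the closure is within distance 1 of the cell, hence the bound [M + 1]. *)
have [y [Ky /=]] := clx _ (nbhsx_ballx x 1 ltr01).
rewrite -ball_normE /= => xy1.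
rewrite -(subrK y x) addrC (le_trans (ler_normD _ _))// lerD ?KM//.
exact: ltW.
Qed.

Lemma surf_face_lty K s : faces_of K s -> (surf s (face_set s) < +oo)%E.
Proof.
move=> sK; apply: surface_measure_lty; first exact: face_dir_isometric.
  exact: face_measurable.
exact: bounded_face sK.
Qed.

Lemma face_ae_null s : \forall x \ae leb, ~ face_set s x.
Proof.
(* [nu] is orthogonal to all directions of the face. It can be taken nonzero because [P] has [d.-1]
   rows and [d.-1 < d] for positive [d]. *)
pose P := face_dir s; pose nu := nz_row (kermx P^T).
have nu0 : nu != 0.
  rewrite nz_row_eq0 -mxrank_eq0 mxrank_ker subn_eq0 -ltnNge.
  by rewrite (leq_ltn_trans (rank_leq_col _))// prednK.
have nuP : nu *m P^T = 0 by apply/sub_kermxP; exact: nz_row_sub.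
apply: (@negligibleS _ _ _ _ [set x | dotv nu x = dotv nu (face_base s)]).
  move=> x /contrapT /face_planar[y _ <-] /=.
  by rewrite !dotvE /plane_chart linearD/= mulmxDr trmx_mul mulmxA nuP mul0mx addr0.
apply/negligibleP; last exact: lebesgue_hyperplane0.
rewrite -[X in measurable X]setTI.
exact: (measurable_dotv nu measurableT (measurable_set1 (dotv nu (face_base s)))).
Qed.

(** A point of [Om] lies in the closure of some cell; if it is not in that cell, it is on the
    boundary, hence on a face, and faces are null. *)
Lemma ae_in_cell : \forall x \ae leb, Om x -> exists K, cell_set K x.
Proof.
have : \forall x \ae leb, forall s : face D, ~ face_set s x.
  apply: (@filter_forall _ (face D) (fun s x => ~ face_set s x) (almost_everywhere leb)).
  by move=> s; exact: face_ae_null.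
apply: filterS => x xs Omx.
have : closure Om x by exact: subset_closure.
rewrite (cell_cover D) => -[K _ clKx]; exists K; apply: contrapT => nKx.
have : (\bigcup_K boundary (cell_set (m:=D) K)) x.
  by exists K => //; split => // /interior_subset.
by rewrite face_cover => -[s _]; exact: xs.
Qed.

Lemma cellwiseE (v : dofs D) K x : cell_set K x -> cellwise v x = v.1 K x.
Proof.
move=> Kx; rewrite /cellwise (bigD1 K)//= big1 ?addr0 => [|L LK].
  by rewrite patchE mem_set.
rewrite patchE memNset// => Lx.
by have := cell_disjoint LK; rewrite -subset0 => /(_ x); exact.
Qed.

Lemma tame_cellwise k (v : dofs D) : hho_space k v -> tame Om (cellwise v).
Proof.
move=> [pv _]; apply: tame_sum => K; apply: tame_patch => //.
  exact: measurable_cell.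
exact: (polyfun_tame (measurable_cell K) (bounded_cell K) (pv K)).
Qed.

End mesh_theory.

(** * Discrete gradient and jumps *)

Section discrete_operators.
Context {R : realType} {d : nat} {Om : set 'rV[R]_d} (D : mesh Om).
Local Notation E := 'rV[R]_d.
Local Notation leb := (lebesgue_rV d).
Hypotheses (d_gt0 : (0 < d)%N) (oOm : open Om) (bOm : bounded_set Om).
Variable k : nat.
Implicit Types (K : cell D) (s : face D) (v w l : dofs D) (c : R).

Let mcell K : measurable (cell_set K). Proof. exact: measurable_cell. Qed.

(** The difference is written as the addition of [- c], the form in which gradients and projections
    are known to respond to constants. *)
Lemma dofs1BE v c K : (v - c *: (one_dofs D : dofs D)).1 K = fun x => v.1 K x + (- c).
Proof. by apply/funext => x; rewrite -[c in RHS]mulr1. Qed.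

Lemma dofs2BE v c s : (v - c *: (one_dofs D : dofs D)).2 s = fun x => v.2 s x + (- c).
Proof. by apply/funext => x; rewrite -[c in RHS]mulr1. Qed.

Lemma hho_one : hho_space k (one_dofs D).
Proof. by split=> i; exact: polyfun_cst. Qed.

Lemma hho_interpolate phi : hho_space k (interpolate D k phi).
Proof. by split=> i; exact: L2proj_polyfun. Qed.

Lemma hhoD v w : hho_space k v -> hho_space k w -> hho_space k (v + w).
Proof. by move=> [v1 v2] [w1 w2]; split=> i; exact: polyfunD. Qed.

Lemma hhoB_one v c : hho_space k v -> hho_space k (v - c *: (one_dofs D : dofs D)).
Proof.
move=> [v1 v2]; split=> i; rewrite ?dofs1BE ?dofs2BE; apply: polyfunD => //;
  exact: polyfun_cst.
Qed.

Lemma polyfield0 : polyfield k (cst 0 : E -> E).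
Proof.
move=> i; have := @polyfun_cst R d k 0; congr (polyfun k _).
by apply/funext => x; rewrite mxE.
Qed.

Lemma polyfield_discrete_grad K v : polyfield k (discrete_grad k K v).
Proof.
rewrite /discrete_grad; case: xgetP => [G _ []//|_]; exact: polyfield0.
Qed.

(** The difference quotients coincide, so this holds even where no derivative exists. *)
Lemma gradD_cst (f : E -> R) c : grad (fun x => f x + c) = grad f.
Proof.
apply/funext => x; apply/rowP => i; rewrite !mxE /derive.
by under eq_fun do rewrite /= opprD addrACA subrr addr0.
Qed.

(** The defining properties of the two gradients are equivalent, so [xget] makes the same choice:
    the equality is exact and not only almost everywhere. *)
Lemma discrete_gradB_one K v c :
  discrete_grad k K (v - c *: (one_dofs D : dofs D)) = discrete_grad k K v.
Proof.
rewrite /discrete_grad dofs1BE gradD_cst; congr (xget _ _).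
apply/funext => G; congr (_ /\ _); apply/propext.
have eqs (tau : E -> E) s :
    \int[surf s]_(x in face_set s) (((v - c *: (one_dofs D : dofs D)).2 s x -
      (v.1 K x - c)) * dotv (tau x) (normal K s)) =
    \int[surf s]_(x in face_set s) ((v.2 s x - v.1 K x) * dotv (tau x) (normal K s)).
  by apply: eq_Rintegral => x _; rewrite dofs2BE; congr (_ * _); ring.
by split=> h tau /h ->; congr (_ + _); apply: eq_bigr => s _; rewrite eqs.
Qed.

Lemma discrete_grad_one K : \forall x \ae leb, cell_set K x ->
  discrete_grad k K (one_dofs D) x = 0.
Proof.
have rhs0 (tau : E -> E) :
    \int[leb]_(x in cell_set K) dotv (grad ((one_dofs D).1 K) x) (tau x) +
    \sum_(s | faces_of K s) \int[surf s]_(x in face_set s)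
      (((one_dofs D).2 s x - (one_dofs D).1 K x) * dotv (tau x) (normal K s)) = 0.
  rewrite big1 ?addr0 => [|s _].
    rewrite /Rintegral integral0_eq// => x _; congr EFin.
    rewrite /dotv big1// => i _; rewrite mxE /= (_ : 'D__ _ _ = 0) ?mul0r//.
    exact: derive_cst.
  by rewrite /Rintegral integral0_eq// => x _; rewrite subrr mul0r.
have pG := polyfield_discrete_grad K (one_dofs D).
set G := discrete_grad k K (one_dofs D) in pG *.
have HG tau : polyfield k tau ->
    \int[leb]_(x in cell_set K) dotv (G x) (tau x) = 0.
  (* As the right-hand side vanishes, the zero field has the defining property, so [xget] does
     return a field with that property. *)
  rewrite /G /discrete_grad => ptau; case: xgetP => [H _ [_ ->//]|].
  move=> /(_ (cst 0)) []; split=> [|tau' _]; first exact: polyfield0.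
  rewrite rhs0 /Rintegral integral0_eq// => x _.
  by rewrite /dotv big1// => i _; rewrite mxE mul0r.
have G0 i : \forall x \ae leb, cell_set K x -> G x 0 i = 0.
  apply: Rintegral_sqr_eq0 => //.
  - exact: leb_cell_lty.
  - exact: polyfun_tame (bounded_cell bOm K) (pG i).
  (* Testing with the [i]-th component of [G] along the [i]-th axis gives the integral of its
     square. *)
  pose tau x : E := G x 0 i *: delta_mx 0 i.
  have ptau : polyfield k tau.
    move=> j; rewrite /tau; under eq_fun do rewrite !mxE mulrC.
    exact: polyfunZ.
  rewrite -[RHS](HG tau ptau); apply: eq_Rintegral => x _.
  rewrite /dotv (bigD1 i)//= big1 => [|j ji].
    by rewrite !mxE !eqxx mulr1 addr0.
  by rewrite !mxE (negbTE ji) andbF !mulr0.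
have : \forall x \ae leb, forall i, cell_set K x -> G x 0 i = 0.
  exact: (@filter_forall _ _ (fun i x => cell_set K x -> G x 0 i = 0) (almost_everywhere leb) _ G0).
by apply: filterS => x Gx Kx; apply/rowP => i; rewrite mxE Gx.
Qed.

Lemma jumpB_one K s v c : hho_space k v -> faces_of K s ->
  \forall x \ae surf s, face_set s x ->
    jump k K s (v - c *: (one_dofs D : dofs D)) x = jump k K s v x.
Proof.
move=> [v1 _] sK.
have := L2projD_cst (face_measurable s) (surf_face_lty bOm sK) (bounded_face bOm sK) k (- c) (v1 K).
apply: filterS => x /[apply]; rewrite /jump dofs1BE dofs2BE => ->; ring.
Qed.

Lemma jump_one K s : faces_of K s ->
  \forall x \ae surf s, face_set s x -> jump k K s (one_dofs D) x = 0.
Proof.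
move=> sK.
have := L2proj_cst (face_measurable s) (surf_face_lty bOm sK) (bounded_face bOm sK) k 1.
by apply: filterS => x /[apply]; rewrite /jump/= => ->; rewrite subrr.
Qed.

End discrete_operators.

(** * The forms *)

Section form_theory.
Context {R : realType} {d : nat} {Om : set 'rV[R]_d} (D : mesh Om).
Local Notation E := 'rV[R]_d.
Local Notation leb := (lebesgue_rV d).
Hypotheses (oOm : open Om) (bOm : bounded_set Om).
Variables (k : nat) (Lam : E -> 'M[R]_d) (trLam : cell D -> face D -> E -> 'M[R]_d).
Variables (lam eta_l eta_nl eps : R).
Hypothesis mLam : forall i j, measurable_fun Om (fun x => Lam x i j).
Implicit Types (K : cell D) (s : face D) (v w l : dofs D) (c : R).

Let mOm : measurable Om. Proof. exact: open_measurable_rV. Qed.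
Let mcell K : measurable (cell_set K). Proof. exact: measurable_cell. Qed.

Definition flux K w v (x : E) : R :=
  dotv (mxact (Lam x) (discrete_grad k K w x)) (discrete_grad k K v x).

Lemma measurable_flux K w v : measurable_fun (cell_set K) (flux K w v).
Proof.
have mG u i : measurable_fun (cell_set K) (fun x => discrete_grad k K u x 0 i).
  by have [] := polyfun_tame (mcell K) (bounded_cell bOm K) (polyfield_discrete_grad k K u i).
rewrite /flux /dotv /mxact; apply: measurable_sum => i.
apply: measurable_funM => //; under eq_fun do rewrite mxE.
apply: measurable_sum => j; apply: measurable_funM => //.
under eq_fun do rewrite mxE; apply: measurable_funS (mLam i j) => //.
exact: cell_subset.
Qed.

Lemma tame_polyfun_face K s j f : faces_of K s -> polyfun j f -> tame (face_set s) f.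
Proof.
by move=> sK; apply: polyfun_tame; [exact: face_measurable|exact: bounded_face sK].
Qed.

Lemma tame_jump K s v : hho_space k v -> faces_of K s ->
  tame (face_set s) (jump k K s v).
Proof.
move=> [_ v2] sK; apply: tameB; apply: tame_polyfun_face sK _ => //.
exact: L2proj_polyfun.
Qed.

Definition face_weight K s l (x : E) : R :=
  (expR (L2proj (surf s) (face_set s) k (l.1 K) x) + expR (l.2 s x)) / 2.

Lemma tame_face_weight K s l : hho_space k l -> faces_of K s ->
  tame (face_set s) (face_weight K s l).
Proof.
move=> [_ l2] sK; apply: tameM; last exact: tame_cst.
apply: tameD; apply: tame_expR; apply: tame_polyfun_face sK _ => //.
exact: L2proj_polyfun.
Qed.

Lemma tame_exp_cell K l : hho_space k l -> tame (cell_set K) (fun x => expR (l.1 K x)).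
Proof.
move=> [l1 _]; apply: tame_expR.
exact: polyfun_tame (mcell K) (bounded_cell bOm K) (l1 K).
Qed.

Let one : dofs D := one_dofs D.

(** Every integrand has a factor that vanishes almost everywhere: the discrete gradient of 1 in
    cells, its jump on faces. *)
Lemma form_T_one l w : hho_space k l -> hho_space k w ->
  form_T k Lam trLam eta_l eta_nl eps l w one = 0.
Proof.
move=> hl hw; rewrite /form_T big1// => K _.
have G0 : \forall x \ae leb, cell_set K x -> flux K w one x = 0.
  apply: filterS (discrete_grad_one bOm k K) => x /[apply] G0.
  by rewrite /flux G0 /dotv big1// => i _; rewrite [X in _ * X]mxE mulr0.
have J0 s : faces_of K s ->
    \forall x \ae surf s, face_set s x -> jump k K s one x = 0.
  exact: jump_one.
have mf := @measurable_flux K w one.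
have tJ s (sK : faces_of K s) u (hu : hho_space k u) := tame_jump hu sK.
rewrite /form_TK /form_C /form_S /form_a.
rewrite ae_Rintegral_eq0//; last 2 first.
- by apply: measurable_funM => //; have [] := tame_exp_cell K hl.
- by apply: filterS G0 => x /[apply]; rewrite /flux => ->; rewrite mulr0.
rewrite ae_Rintegral_eq0// big1 => [|s sK]; last first.
  rewrite ae_Rintegral_eq0 ?mulr0//; first exact: face_measurable.
    have [] // := tameM (tameM (tame_face_weight hl sK) (tJ s sK _ hw)) (tJ s sK _ (hho_one D k)).
  by apply: filterS (J0 s sK) => x /[apply] ->; rewrite mulr0.
rewrite big1 => [|s sK]; first by rewrite !(mulr0, addr0).
rewrite ae_Rintegral_eq0 ?mulr0//; first exact: face_measurable.
  by have [] := tameM (tJ s sK _ hw) (tJ s sK _ (hho_one D k)).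
by apply: filterS (J0 s sK) => x /[apply] ->; rewrite mulr0.
Qed.

(** The volume terms agree because the discrete gradients are equal; only the face integrals need an
    almost everywhere argument. *)
Lemma form_TB_one l w v c : hho_space k l -> hho_space k w -> hho_space k v ->
  form_T k Lam trLam eta_l eta_nl eps l (w - c *: one) v =
  form_T k Lam trLam eta_l eta_nl eps l w v.
Proof.
move=> hl hw hv; rewrite /form_T; apply: eq_bigr => K _.
have tJ s (sK : faces_of K s) u (hu : hho_space k u) := tame_jump hu sK.
have hwc := hhoB_one c hw.
have J s : faces_of K s -> \forall x \ae surf s, face_set s x ->
    jump k K s (w - c *: one) x = jump k K s w x by exact: jumpB_one.
rewrite /form_TK /form_C /form_S /form_a discrete_gradB_one.
congr (_ + _ * _ + _ * (_ + _ * _)); apply: eq_bigr => s sK; congr (_ * _).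
  apply: ae_eq_Rintegral; first exact: face_measurable.
  - by have [] := tameM (tameM (tame_face_weight hl sK) (tJ s sK _ hwc)) (tJ s sK _ hv).
  - by have [] := tameM (tameM (tame_face_weight hl sK) (tJ s sK _ hw)) (tJ s sK _ hv).
  - by apply: filterS (J s sK) => x /[apply] ->.
apply: ae_eq_Rintegral; first exact: face_measurable.
- by have [] := tameM (tJ s sK _ hwc) (tJ s sK _ hv).
- by have [] := tameM (tJ s sK _ hw) (tJ s sK _ hv).
- by apply: filterS (J s sK) => x /[apply] ->.
Qed.

Lemma diam_ge0 (X : set E) : 0 <= diam X.
Proof.
rewrite /diam.
set S := (X in sup X).
(* [sup] is 0 when no supremum exists; otherwise it dominates some distance. *)
have [[[r Sr] [M SM]]|/sup_out ->//] := pselect (has_sup S).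
rewrite (le_trans _ (ub_le_sup _ Sr))//; last by exists M.
by case: Sr => x _ [y _ <-]; exact: sqrtr_ge0.
Qed.

Lemma LamKs_ge0 K s : 0 <= LamKs trLam K s.
Proof. by rewrite /LamKs fine_ge0// Lnorm_ge0. Qed.

Hypotheses (lam_gt0 : 0 < lam) (eta_l_gt0 : 0 < eta_l) (eta_nl_gt0 : 0 < eta_nl)
  (eps_ge0 : 0 <= eps).
Hypothesis Lam_elliptic : \forall x \ae leb, Om x -> forall xi : E,
  lam * enorm xi ^+ 2 <= dotv (mxact (Lam x) xi) xi.

(** Ellipticity makes the volume integrands non-negative almost everywhere; the face terms are
    squares with non-negative weights. *)
Lemma form_T_ge0 l w : hho_space k l ->
  0 <= form_T k Lam trLam eta_l eta_nl eps l w w.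
Proof.
move=> hl; apply: sumr_ge0 => K _.
have f0 : \forall x \ae leb, cell_set K x -> 0 <= flux K w w x.
  apply: filterS Lam_elliptic => x ell /cell_subset /ell.
  move=> /(_ (discrete_grad k K w x)); apply: le_trans.
  by rewrite mulr_ge0 ?sqr_ge0// ltW.
have mf := @measurable_flux K w w.
have LD0 s : 0 <= LamKs trLam K s / diam (face_set s).
  by rewrite divr_ge0// ?LamKs_ge0// diam_ge0.
rewrite /form_TK /form_C /form_S /form_a.
apply: addr_ge0; first apply: addr_ge0.
- apply: ae_Rintegral_ge0 => //.
    by apply: measurable_funM => //; have [] := tame_exp_cell K hl.
  by apply: filterS f0 => x /[apply] f0; rewrite mulr_ge0// expR_ge0.
- rewrite mulr_ge0 ?(ltW eta_nl_gt0)// sumr_ge0// => s _; rewrite mulr_ge0//.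
  apply: Rintegral_ge0 => x _; rewrite -mulrA -expr2 mulr_ge0 ?sqr_ge0//.
- apply: mulr_ge0; first by rewrite mulr_ge0 ?exprn_ge0 ?diam_ge0.
  apply: addr_ge0.
    exact: ae_Rintegral_ge0.
  rewrite mulr_ge0 ?(ltW eta_l_gt0)// sumr_ge0// => s _; rewrite mulr_ge0//.
  by apply: Rintegral_ge0 => x _; rewrite -expr2 sqr_ge0.
Qed.

End form_theory.

(** * Relative entropy *)

Section relative_entropy.
Context {R : realType}.

Lemma Phi1E (s : R) : Phi1 s = s * ln s - s + 1.
Proof. by rewrite /Phi1; case: eqP => // ->; rewrite mul0r subrr add0r. Qed.

(** For positive [x], multiply [1 + t <= expR t] at [t = - ln x] by [x] to get [x - 1 <= x * ln x].
    For other [x], [ln x] is 0 by convention. *)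
Lemma xlnx_geN1 (x : R) : - 1 <= x * ln x.
Proof.
have [x0|x0] := leP x 0; first by rewrite ln0// mulr0 lerN10.
have := expR_ge1Dx (- ln x); rewrite expRN lnK// => h.
have : x * (1 - ln x) <= x * x^-1 by rewrite ler_pM2l.
rewrite mulfV ?gt_eqF//; nra.
Qed.

Lemma Phi1_perspectiveE (e u : R) : 0 < e -> 0 <= u ->
  e * Phi1 (u / e) = u * ln u - u * ln e - u + e.
Proof.
move=> e0; rewrite le_eqVlt => /predU1P[<-|u0]; rewrite Phi1E.
  by rewrite !mul0r !subr0 !add0r mulr1.
rewrite ln_div//; field; exact: lt0r_neq0.
Qed.

(** Negative [u] are included because the initial density is non-negative only almost everywhere,
    while the domination used for integrability is pointwise. *)
Lemma normr_Phi1_perspective_le (e u : R) : 0 < e ->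
  `|e * Phi1 (u / e)| <= `|u * ln u| + `|u * ln e| + `|u| + e.
Proof.
move=> e0; have ee : `|e| = e by rewrite gtr0_norm.
have [u0|u0] := leP 0 u.
  rewrite Phi1_perspectiveE// (le_trans (ler_normD _ _))// ee lerD2r.
  by rewrite (le_trans (ler_normB _ _))// lerD2r ler_normB.
have ue : u / e <= 0 by rewrite ltW// pmulr_llt0// invr_gt0.
rewrite Phi1E (ln0 ue) mulr0 add0r.
have -> : e * (- (u / e) + 1) = - u + e by field; exact: lt0r_neq0.
by rewrite (le_trans (ler_normD _ _))// normrN ee lerD2r lerDr addr_ge0.
Qed.

(* Tangent line inequality for the convex function Phi1 at u1 / e. *)
Lemma Phi1_perspective_sub_le (e L u0 : R) : 0 < e -> 0 <= u0 ->
  e * Phi1 (expR L / e) - e * Phi1 (u0 / e) <= (expR L - u0) * (L - ln e).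
Proof.
move=> e0 u0_ge0; rewrite !Phi1_perspectiveE ?expR_ge0// expRK.
(* The terms in [e] cancel. What remains is [1 + t <= expR t] at [t = L - ln u0], multiplied by
   [u0]. *)
suff : u0 * (L - ln u0) <= expR L - u0 by lra.
move: u0_ge0; rewrite le_eqVlt => /predU1P[<-|u0_gt0].
  by rewrite mul0r subr0 expR_ge0.
have := expR_ge1Dx (L - ln u0); rewrite expRB lnK ?posrE// => h.
have : u0 * (1 + (L - ln u0)) <= u0 * (expR L / u0) by rewrite ler_pM2l.
rewrite [X in _ <= X]mulrC divfK ?gt_eqF//; lra.
Qed.

Context {dd : measure_display} {T : measurableType dd}.
Variables (mu : {measure set T -> \bar R}) (X : set T).
Hypotheses (mX : measurable X) (muX : (mu X < +oo)%E).

(** On a set of finite measure the lower bound makes the negative part integrable, so an integral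
    below +oo forces the positive part to be integrable too. It serves for [u * ln u] at the initial
    time. *)
Lemma integrable_of_lower_bound (c : R) (f : T -> R) : measurable_fun X f ->
  (forall x, X x -> c <= f x) -> (\int[mu]_(x in X) (f x)%:E < +oo)%E ->
  mu.-integrable X (EFin \o f).
Proof.
move=> mf cf foo; have mfE : measurable_fun X (EFin \o f) by exact/measurable_EFinP.
have fneg : (\int[mu]_(x in X) (EFin \o f)^\- x < +oo)%E.
  apply: (@le_lt_trans _ _ (\int[mu]_(x in X) (cst `|c|%:E x))%E).
    apply: ge0_le_integral => //; first exact: measurable_funeneg.
    move=> x Xx; rewrite funenegE /= -EFin_max lee_fin ge_max normr_ge0 andbT.
    by rewrite (@le_trans _ _ (- c)) ?lerN2 ?cf// -normrN ler_norm.
  by rewrite integral_cst// lte_mul_pinfty.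
have fpos : (\int[mu]_(x in X) (EFin \o f)^\+ x < +oo)%E.
  move: foo; rewrite integralE.
  have : (0 <= \int[mu]_(x in X) (EFin \o f)^\- x)%E by exact: integral_ge0.
  move: fneg; case: (integral _ _ (_^\-)%E) => // r _ _.
  by case: (integral _ _ (_^\+)%E) => //= t _; rewrite ltry.
apply/integrableP; split => //.
rewrite (eq_integral (fun x => (EFin \o f)^\+ x + (EFin \o f)^\- x)%E); last first.
  by move=> x _; rewrite -[LHS]/((abse \o (EFin \o f)) x) fune_abse.
rewrite ge0_integralD//; last 2 first.
- exact: measurable_funepos.
- exact: measurable_funeneg.
exact: lte_add_pinfty.
Qed.

Lemma integrable_tameM (f g : T -> R) : mu.-integrable X (EFin \o f) ->
  tame X g -> mu.-integrable X (EFin \o (fun x => f x * g x)).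
Proof.
move=> fi [mg bg]; rewrite (_ : _ \o _ = ((EFin \o f) \* (EFin \o g))%E) //.
by apply: integrableMl => //; exact/bounded_imageP.
Qed.

Lemma integrable_addr (f g : T -> R) :
  mu.-integrable X (EFin \o f) -> mu.-integrable X (EFin \o g) ->
  mu.-integrable X (EFin \o (fun x => f x + g x)).
Proof. exact: integrableD. Qed.

Variable e : T -> R.
Hypotheses (e_gt0 : forall x, 0 < e x) (te : tame X e) (tVe : tame X (fun x => (e x)^-1))
  (tlne : tame X (fun x => ln (e x))).

Lemma integrable_Phi1_perspective (u : T -> R) :
  mu.-integrable X (EFin \o u) ->
  mu.-integrable X (EFin \o (fun x => u x * ln (u x))) ->
  mu.-integrable X (EFin \o (fun x => e x * Phi1 (u x / e x))).
Proof.
move=> ui ulnui; have mu_ : measurable_fun X u.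
  by apply/measurable_EFinP; exact: measurable_int ui.
have Vm : measurable_fun X (fun x => u x / e x).
  by apply: measurable_funM => //; case: tVe.
apply: (@le_integrable _ _ _ _ _ mX _
  (EFin \o (fun x => `|u x * ln (u x)| + `|u x * ln (e x)| + `|u x| + e x))).
- apply/measurable_EFinP; under eq_fun do rewrite Phi1E.
  apply: measurable_funM; first by case: te.
  apply: measurable_funD => //; apply: measurable_funB => //.
  by apply: measurable_funM => //; exact: measurableT_comp.
- move=> x Xx; rewrite lee_fin [leRHS]ger0_norm.
    exact: normr_Phi1_perspective_le.
  by rewrite !addr_ge0// ltW.
- have ulnei := integrable_tameM ui tlne.
  apply: integrable_addr; last exact: tame_integrable.
  by apply: integrable_addr; [apply: integrable_addr|]; exact: integrable_norm.
Qed.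

Lemma entropy_sub_le (L u0 : T -> R) : tame X L ->
  mu.-integrable X (EFin \o u0) ->
  mu.-integrable X (EFin \o (fun x => u0 x * ln (u0 x))) ->
  (\forall x \ae mu, X x -> 0 <= u0 x) ->
  \int[mu]_(x in X) (e x * Phi1 (expR (L x) / e x)) -
  \int[mu]_(x in X) (e x * Phi1 (u0 x / e x)) <=
  \int[mu]_(x in X) ((expR (L x) - u0 x) * (L x - ln (e x))).
Proof.
move=> tL u0i u0lni u0_ge0.
have u1i := tame_integrable mX muX (tame_expR tL).
have u1lni : mu.-integrable X (EFin \o (fun x => expR (L x) * ln (expR (L x)))).
  by under eq_fun do rewrite expRK; apply: integrable_tameM.
rewrite -RintegralB//; try exact: integrable_Phi1_perspective.
apply: ae_le_Rintegral => //.
- apply: (integrableB mX (f := EFin \o (fun x => e x * Phi1 (expR (L x) / e x)))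
    (g := EFin \o (fun x => e x * Phi1 (u0 x / e x)))); exact: integrable_Phi1_perspective.
- apply: integrable_tameM; last exact: tameB.
  exact: (integrableB mX u1i u0i).
- by apply: filterS u0_ge0 => x /[apply]; exact: Phi1_perspective_sub_le.
Qed.

End relative_entropy.

(** * Mass conservation and entropy dissipation for the scheme *)

Theorem proposition1 (R : realType) (d : nat) (Om : set 'rV[R]_d)
    (D : mesh Om) (k : nat) (Lam : 'rV[R]_d -> 'M[R]_d)
    (trLam : cell D -> face D -> 'rV[R]_d -> 'M[R]_d) (lam : R)
    (phi uin : 'rV[R]_d -> R) (eta_l eta_nl eps dt : R) (l : nat -> dofs D) :
  d = 2%N \/ d = 3%N ->
  open Om -> bounded_set Om -> connected Om -> polytopal Om ->
  (forall i j, in_Linfty (lebesgue_rV d) Om (fun x => Lam x i j)) ->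
  0 < lam ->
  (\forall x \ae lebesgue_rV d, Om x -> forall xi : 'rV[R]_d,
     lam * enorm xi ^+ 2 <= dotv (mxact (Lam x) xi) xi) ->
  (forall K s, faces_of K s -> forall i j,
     is_trace (cell_set K) (face_set s) (surf s)
       (fun x => Lam x i j) (fun x => trLam K s x i j)) ->
  (forall K s, faces_of K s ->
     in_Linfty (surf s) (face_set s) (normal_diffusion trLam K s)) ->
  C1_closure Om phi ->
  (lebesgue_rV d).-integrable Om (EFin \o uin) ->
  (\forall x \ae lebesgue_rV d, Om x -> 0 <= uin x) ->
  (\int[lebesgue_rV d]_(x in Om) (uin x * ln (uin x))%:E < +oo)%E ->
  0 < mass Om uin ->
  0 < eta_l -> 0 < eta_nl -> 0 <= eps -> 0 < dt ->
  scheme_solution k Lam trLam eta_l eta_nl eps phi uin dt l ->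
  (forall n, (0 < n)%N ->
     \int[lebesgue_rV d]_(x in Om) density uin l n x =
       \int[lebesgue_rV d]_(x in Om) uin x /\
     \int[lebesgue_rV d]_(x in Om) uin x = mass Om uin) /\
  (forall n, (entropy k phi uin l n.+1 - entropy k phi uin l n) / dt <=
     - dissipation k Lam trLam eta_l eta_nl eps phi uin l n.+1) /\
  (forall n, (0 < n)%N ->
     0 <= dissipation k Lam trLam eta_l eta_nl eps phi uin l n).
Proof.
move=> d23 oOm bOm _ _ mLam lam0 ell _ _ _ uini uin0 uinln mass0 etal0 etanl0 eps0 dt0 [hl sch].
have d0 : (0 < d)%N by case: d23 => ->.
have mOm := open_measurable_rV oOm.
have muOm := bounded_lebesgue_rV mOm bOm.
have {mLam}mLam i j : measurable_fun Om (fun x => Lam x i j) by have [] := mLam i j.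
have hphi := hho_interpolate D k phi.
have tphi := tame_cellwise oOm bOm hphi.
have tl n : (0 < n)%N -> tame Om (cellwise (l n)).
  by move=> n0; exact: tame_cellwise (hl n n0).
have ui n : (lebesgue_rV d).-integrable Om (EFin \o density uin l n).
  case: n => [//|n]; apply: tame_integrable => //; apply: tame_expR; exact: tl.
have in_cell := ae_in_cell D d0.
have hw n : (0 < n)%N -> hho_space k (potential k phi uin l n).
  by move=> n0; apply: hhoB_one; apply: hhoD => //; exact: hl.
have massE n : \int[lebesgue_rV d]_(x in Om) density uin l n x = mass Om uin.
  elim: n => [//|n <-].
  (* The test function 1 has reconstruction 1 on cells, hence almost everywhere in [Om]. *)
  have := sch n _ (hho_one D k); rewrite form_T_one ?oppr0//; last 2 first.
  - exact: hl.
  - by apply: hhoD => //; exact: hl.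
  have t1 := tame_cellwise oOm bOm (hho_one D k).
  have dui : (lebesgue_rV d).-integrable Om
      (EFin \o (fun x => density uin l n.+1 x - density uin l n x)).
    exact: (integrableB mOm (ui n.+1) (ui n)).
  rewrite (@ae_eq_Rintegral _ _ _ _ _ _
      (fun x => dt^-1 * (density uin l n.+1 x - density uin l n x)))//; last 3 first.
  - apply/measurable_EFinP/measurable_int.
    apply: (integrable_tameM _ _ t1) => //.
    apply: (integrable_tameM mOm dui (tame_cst Om dt^-1)).
  - apply: measurable_funM => //; apply/measurable_EFinP; exact: measurable_int dui.
  - apply: filterS in_cell => x /[apply] -[K Kx]; rewrite (cellwiseE _ Kx)/= mulr1.
    by rewrite mulrC.
  rewrite RintegralZl// RintegralB// => /eqP.
  by rewrite mulf_eq0 invr_eq0 gt_eqF//= subr_eq0 => /eqP.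
(* On a null set the mass would be 0. *)
have muOm0 : (0 < lebesgue_rV d Om)%E.
  rewrite lt0e measure_ge0 andbT; apply: contraTneq mass0 => Om0.
  rewrite -leNgt /mass ae_Rintegral_eq0//; last exact: ae_eq0.
  by apply/measurable_EFinP; exact: measurable_int uini.
have rho0 : 0 < rho D k phi uin.
  apply: divr_gt0 => //.
  have [_ [M phiM]] := tphi.
  have tephi : tame Om (fun x => expR (- cellwise (interpolate D k phi) x)).
    apply: tame_expR; under eq_fun do rewrite -sub0r; apply: tameB => //.
    exact: tame_cst.
  (* The reconstruction of [phi] is at most [M], which bounds the denominator of [rho] below by a
     positive constant times the measure of [Om]. *)
  apply: (@lt_le_trans _ _ (\int[lebesgue_rV d]_(x in Om) expR (- M))).
    by rewrite Rintegral_cst// mulr_gt0 ?expR_gt0// fine_gt0// muOm0.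
  apply: le_Rintegral => //.
  - by apply: tame_integrable => //; exact: tame_cst.
  - exact: tame_integrable.
  - by move=> x Omx; rewrite ler_expR lerN2 (le_trans (ler_norm _))// phiM.
split; first by move=> n _; rewrite massE.
split=> [n|n n0]; last first.
  exact: (form_T_ge0 oOm bOm trLam mLam lam0 etal0 etanl0 eps0 ell _ (hl n n0)).
set e := equilibrium D k phi uin.
have e_gt0 x : 0 < e x by rewrite mulr_gt0// expR_gt0.
have lneE x : ln (e x) = ln (rho D k phi uin) - cellwise (interpolate D k phi) x.
  by rewrite /e /equilibrium lnM ?posrE ?expR_gt0// expRK.
have te : tame Om e.
  apply: tameM; first exact: tame_cst.
  apply: tame_expR; under eq_fun do rewrite -sub0r; apply: tameB => //.
  exact: tame_cst.
have tVe : tame Om (fun x => (e x)^-1).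
  rewrite /e /equilibrium; under eq_fun do rewrite invfM -expRN opprK.
  by apply: tameM; [exact: tame_cst|exact: tame_expR].
have tlne : tame Om (fun x => ln (e x)).
  by under eq_fun do rewrite lneE; apply: tameB => //; exact: tame_cst.
have u_ge0 : \forall x \ae lebesgue_rV d, Om x -> 0 <= density uin l n x.
  case: n => [//|n]; apply: aeW => x _; exact: expR_ge0.
have ulni : (lebesgue_rV d).-integrable Om
    (EFin \o (fun x => density uin l n x * ln (density uin l n x))).
  (* At later times [u * ln u] is a product of tame functions; at the initial time only the lower
     bound and the finite entropy are available. *)
  case: n {u_ge0} => [|n]; last first.
    under eq_fun do rewrite /= expRK; apply: integrable_tameM => //; last exact: tl.
    exact: ui n.+1.
  apply: (integrable_of_lower_bound mOm muOm (c := -1)) => // [|x _].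
    have um : measurable_fun Om uin by apply/measurable_EFinP; exact: measurable_int uini.
    by apply: measurable_funM => //; exact: measurableT_comp.
  exact: xlnx_geN1.
have tL := tl n.+1 isT.
have := entropy_sub_le mOm muOm e_gt0 te tVe tlne tL (ui n) ulni u_ge0.
rewrite -/(entropy k phi uin l n.+1) -/(entropy k phi uin l n) => Ele.
rewrite ler_pdivrMr// (le_trans Ele)//.
have dui : (lebesgue_rV d).-integrable Om
    (EFin \o (fun x => density uin l n.+1 x - density uin l n x)).
  exact: (integrableB mOm (ui n.+1) (ui n)).
have tw := tame_cellwise oOm bOm (hw n.+1 isT).
have duwi := integrable_tameM mOm (integrable_tameM mOm dui (tame_cst Om dt^-1)) tw.
(* The constant [ln rho] is dropped from the second argument of the form, which then reads as in the
   scheme; it stays in the test function. *)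
have -> : dissipation k Lam trLam eta_l eta_nl eps phi uin l n.+1 =
    form_T k Lam trLam eta_l eta_nl eps (l n.+1)
      (l n.+1 + interpolate D k phi) (potential k phi uin l n.+1).
  by apply: form_TB_one => //; [exact: hl|apply: hhoD => //; exact: hl|exact: hw].
rewrite -(sch n _ (hw n.+1 isT)) -RintegralZr//.
rewrite le_eqVlt; apply/orP; left; apply/eqP; apply: ae_eq_Rintegral => //.
- apply/measurable_EFinP; apply: measurable_int.
  by apply: (integrable_tameM mOm dui); exact: tameB.
- apply/measurable_EFinP; apply: measurable_int.
  exact: (integrable_tameM mOm duwi (tame_cst Om dt)).
(* On a cell, [ln] of the new density minus [ln (e x)] is the cell value of the potential, so the
   two integrands agree. *)
apply: filterS in_cell => x /[apply] -[K Kx]; rewrite lneE !(cellwiseE _ Kx).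
rewrite dofs1BE [density uin l n.+1 x]/= (cellwiseE _ Kx).
rewrite (_ : (l n.+1 + interpolate D k phi).1 K x = (l n.+1).1 K x + (interpolate D k phi).1 K x)//.
by field; rewrite gt_eqF.
Qed.
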